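(* Let the weight vector $\vec w=(w_1,\dots,w_N)$ satisfy $\max_{n\in[N]}w_n<1/M$, where $M$ is the desired committee size. Then the sortition algorithm Stitch (with input $\vec w$ and $M$) is fair, i.e. $\mathbb{E}[g(n;\mathcal{M})]=w_n$ for all $n\in[N]$, and the committee $\mathcal{M}$ is of size $M$.
   Context: Setting: there are $N$ participants, indexed by $[N]=\{1,\dots,N\}$; participant $i$ has a positive weight $w_i$, and the weights are normalized, $\sum_{i=1}^N w_i=1$. A sortition algorithm outputs a random committee $\mathcal{M}\subseteq[N]$ and unnormalized weights $g_n$, $n\in[N]$; the voting power of participant $n$ is $g(n;\mathcal{M})=g_n/\sum_{m\in\mathcal{M}}g_m$ for $n\in\mathcal{M}$ and $g(n;\mathcal{M})=0$ for $n\notin\mathcal{M}$. Fairness means that the expected voting power of every participant equals its initial weight: $\mathbb{E}[g(n;\mathcal{M})]=w_n$ for all $n\in[N]$. Algorithm Stitch (input $\vec w$, $M$): (1, optional) apply a random permutation of the set of participants to $\vec w=(w_1,\dots,w_N)$; (2) divide the interval $[0,1]$ into subintervals of length $w_i$, each participant $i$ being assigned its own subinterval; (3) sample a point $x$ with uniform distribution in $[0,1]$; (4) form the committee $\mathcal{M}$ by taking all participants whose subintervals contain one of the points $\{x+i/M\}$ with $i\in[M]=\{1,\dots,M\}$, where $\{\cdot\}$ denotes the fractional part; (5) set $g_i=1$ for $i\in\mathcal{M}$ and $g_i=0$ for $i\notin\mathcal{M}$. *)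

(* Defs.v *)
From HB Require Import structures.
From mathcomp Require Import all_boot all_order all_algebra all_fingroup.
From mathcomp Require Import all_classical all_reals all_analysis.
Import Order.TTheory GRing.Theory Num.Theory.

Set Implicit Arguments.
Unset Strict Implicit.
Unset Printing Implicit Defensive.

Local Open Scope classical_set_scope.
Local Open Scope ring_scope.

(* The N participants are the elements of 'I_N, i.e. numbered from 0. *)

Definition voting_power (R : realType) (N : nat)
    (C : {set 'I_N}) (g : 'I_N -> R) (n : 'I_N) : R :=
  if n \in C then g n / \sum_(m in C) g m else 0.

(* C and g are the random committee and the random unnormalized weights output
   by a sortition algorithm. Integrability is required so that the expectation
   is meaningful: the library's integral is total. *)
Definition fair d (T : measurableType d) (R : realType) (P : probability T R)
    (N : nat) (w : 'I_N -> R) (C : T -> {set 'I_N}) (g : T -> 'I_N -> R) :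
    Prop :=
  forall n : 'I_N,
    P.-integrable [set: T] (fun t => (voting_power (C t) (g t) n)%:E) /\
    ('E_P[fun t => voting_power (C t) (g t) n] = (w n)%:E)%E.

Definition frac (R : realType) (x : R) : R := x - (Num.floor x)%:~R.

(* Half-open, so that the subintervals are pairwise disjoint and cover [0, 1[,
   in which fractional parts lie. *)
Definition subinterval (R : realType) (N : nat) (v : 'I_N -> R) (j : 'I_N) :
    interval R :=
  `[\sum_(k < N | (k < j)%N) v k, \sum_(k < N | (k <= j)%N) v k[.

(* The index i of 'I_M stands for i.+1 in {1, ..., M}. *)
Definition line_committee (R : realType) (N M : nat) (v : 'I_N -> R) (x : R) :
    {set 'I_N} :=
  [set j | [exists i : 'I_M,
     frac (x + i.+1%:R / M%:R) \in subinterval v j]]%SET.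

(* After the permutation step, position j on the line is occupied by the
   participant s j, with its weight w (s j); the committee consists of the
   participants occupying the selected positions. *)
Definition stitch_committee (R : realType) (N M : nat) (w : 'I_N -> R)
    (s : {perm 'I_N}) (x : R) : {set 'I_N} :=
  (s @: line_committee M (fun j => w (s j)) x)%SET.

Definition stitch_weights (R : realType) (N : nat) (C : {set 'I_N})
    (i : 'I_N) : R :=
  if i \in C then 1 else 0.

Definition uniform01 d (T : measurableType d) (R : realType)
    (P : probability T R) (X : {RV P >-> R}) : Prop :=
  forall A : set R, measurable A ->
    distribution P X A = uniform_prob (@ltr01 R) A.

(* The permutation step is optional. If it is performed, s is a uniformly
   distributed random permutation, independent of the sampled point X. *)
Definition permutation_step d (T : measurableType d) (R : realType)
    (P : probability T R) (X : {RV P >-> R}) (N : nat)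
    (permute : bool) (s : T -> {perm 'I_N}) : Prop :=
  if permute then
    [/\ forall p, measurable (s @^-1` [set p]),
        forall p, P (s @^-1` [set p]) = (N`!%:R^-1)%:E
      & forall p (A : set R), measurable A ->
          P (s @^-1` [set p] `&` X @^-1` A) =
          (P (s @^-1` [set p]) * P (X @^-1` A))%E]
  else forall t, s t = 1%g.

(* Main.v *)
(* The points {x + i/M} are pairwise at distance at least 1/M on the circle, and
   every subinterval is shorter than 1/M, so sending a point to the subinterval
   containing it is injective: the committee has exactly M members and every
   voting power is 0 or 1/M. Each {x + i/M} is uniform on [0, 1[, and for a given
   participant the M events "the i-th point falls in its subinterval" are
   disjoint, so a participant of weight w is selected with probability M w,
   wherever its subinterval is; hence conditioning on the permutation changes
   nothing. *)
Require Import Defs.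
From HB Require Import structures.
From mathcomp Require Import all_boot all_order all_algebra all_fingroup.
From mathcomp Require Import all_classical all_reals all_analysis.
From mathcomp Require Import measurable_realfun ring lra zify.
Import Order.TTheory GRing.Theory Num.Theory.

Local Open Scope classical_set_scope.
Local Open Scope ring_scope.

(** * Fractional parts of points spaced by multiples of [1 / M] *)

Lemma frac_itv (R : realType) (x : R) : 0 <= Defs.frac x < 1.
Proof.
have := floor_itv x; rewrite /Defs.frac intrD => /andP[h1 h2].
by apply/andP; split; lra.
Qed.

Lemma frac_eq (R : realType) (x : R) (z : int) :
  0 <= x - z%:~R < 1 -> Defs.frac x = x - z%:~R.
Proof.
move=> /andP[h1 h2]; rewrite /Defs.frac (@floor_def _ x z)// intrD.
by apply/andP; split; lra.
Qed.

Lemma frac_shift_inj (R : realType) (M : nat) (x a b : R) (i j : 'I_M) :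
  b - a < 1 / M%:R ->
  Defs.frac (x + i.+1%:R / M%:R) \in `[a, b[ ->
  Defs.frac (x + j.+1%:R / M%:R) \in `[a, b[ -> i = j.
Proof.
have M0 : (0 < M)%N by case: M i {j} => [[]|].
have MR : 0 < M%:R :> R by rewrite ltr0n.
rewrite ltr_pdivlMr// !in_itv/= /Defs.frac.
set p := Num.floor _; set q := Num.floor _.
move=> ab /andP[h1 h2] /andP[h3 h4].
(* [D / M] is the difference of the two fractional parts, so the integer [D]
   vanishes, i.e. [M] divides [i - j]. *)
pose D : int := i%:Z - j%:Z - (p - q) * M%:Z.
have DE : D%:~R = ((x + i.+1%:R / M%:R - p%:~R)
                   - (x + j.+1%:R / M%:R - q%:~R)) * M%:R.
  rewrite /D !(intrB, intrM) -!pmulrn -!natr1.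
  by field; rewrite lt0r_neq0.
have D1 : `|D%:~R : R| < 1.
  rewrite DE normrM (gtr0_norm MR); apply: le_lt_trans ab.
  by rewrite ler_pM2r// ler_norml; apply/andP; split; lra.
have D0 : D = 0.
  move: D1; rewrite -intr_norm ltrz1 => D1; apply/eqP; rewrite -normr_eq0.
  by move: D1 (normr_ge0 D); lia.
apply/val_inj => /=.
have := ltn_ord i; have := ltn_ord j; move: D0; rewrite /D.
(* Since [i] and [j] are both below [M], a nonzero [p - q] would make [(p - q) * M] too large; the
   sign split lets [nia] bound that product. *)
by have [|[]] : p - q = 0 \/ p - q >= 1 \/ p - q <= -1; [lia|nia..].
Qed.

(** * Partition of [[0, 1[] into subintervals, and the size of the committee *)

Section positions.
Variables (R : realType) (N : nat) (v : 'I_N -> R).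
Hypothesis v_ge0 : forall j, 0 <= v j.

Lemma le_partial_sum (m n : nat) : (m <= n)%N ->
  \sum_(k < N | (k < m)%N) v k <= \sum_(k < N | (k < n)%N) v k.
Proof.
move=> mn; rewrite [leLHS]big_mkcond [leRHS]big_mkcond; apply: ler_sum => k _.
case: ifPn => [km|_]; first by rewrite (leq_trans km mn).
by case: ifP.
Qed.

(** Writing the right end with [k < j.+1] makes both ends values of the same partial sum, so that
    [le_partial_sum] and minimality arguments apply. *)
Lemma subintervalE j (y : R) : (y \in subinterval v j) =
  (\sum_(k < N | (k < j)%N) v k <= y < \sum_(k < N | (k < j.+1)%N) v k).
Proof. by rewrite in_itv. Qed.

Lemma subinterval_inj (y : R) i j :
  y \in subinterval v i -> y \in subinterval v j -> i = j.
Proof.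
wlog ij : i j / (i < j)%N => [W|].
  move=> yi yj; case: (ltngtP i j) => [ij|ji|/val_inj//]; first exact: W.
  by apply/esym; exact: W.
rewrite !subintervalE => /andP[_ h1] /andP[h2 _].
by have := le_lt_trans (le_trans (le_partial_sum _ _ ij) h2) h1; rewrite ltxx.
Qed.

Lemma subinterval_cover (y : R) : \sum_j v j = 1 -> 0 <= y < 1 ->
  exists j, y \in subinterval v j.
Proof.
move=> v1 /andP[y0 y1].
have SN : \sum_(k < N | (k < N)%N) v k = 1.
  by rewrite -v1; apply: eq_bigl => k; exact: ltn_ord.
have ex : exists m, y < \sum_(k < N | (k < m)%N) v k by exists N; rewrite SN.
(* The position sought is the predecessor of the least index whose partial sum exceeds [y]; that
   index is not 0, because the empty sum is at most [y]. *)
case: (ex_minnP ex) => -[|m]; first by rewrite big_pred0// ltNge y0.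
move=> ym minm; have mN : (m < N)%N.
  by apply: minm; rewrite SN.
exists (Ordinal mN); rewrite subintervalE /= ym andbT leNgt.
by apply/negP => /minm; rewrite ltnn.
Qed.

Lemma subinterval_length (j : 'I_N) :
  \sum_(k < N | (k <= j)%N) v k - \sum_(k < N | (k < j)%N) v k = v j.
Proof.
rewrite (bigD1 j)//= [X in _ + X - _](eq_bigl (fun k : 'I_N => (k < j)%N)).
  by rewrite addrK.
by move=> k; rewrite ltn_neqAle andbC.
Qed.

Lemma card_line_committee (M : nat) (x : R) :
  (forall j, v j < 1 / M%:R) -> \sum_j v j = 1 ->
  #|line_committee M v x| = M.
Proof.
move=> vM v1.
pose pos (i : 'I_M) := xchoose
  (subinterval_cover _ v1 (frac_itv _ (x + i.+1%:R / M%:R))).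
have posP (i : 'I_M) : Defs.frac (x + i.+1%:R / M%:R) \in subinterval v (pos i).
  exact: (xchooseP (subinterval_cover _ v1 (frac_itv _ _))).
(* By disjointness, the subinterval chosen by [pos] is the only one containing the point, so the
   committee is exactly the image of [pos]. *)
have -> : line_committee M v x = (pos @: [set: 'I_M])%SET.
  apply/setP => j; rewrite inE; apply/existsP/imsetP.
    by move=> [i ij]; exists i => //; apply: subinterval_inj ij (posP i).
  by move=> [i _ ->]; exists i.
rewrite card_imset ?cardsT ?card_ord// => i i' ii'.
apply: frac_shift_inj (posP i) _; last by rewrite ii'.
by rewrite subinterval_length.
Qed.
End positions.

(** * Finite additivity, and the uniform law under shifts modulo 1 *)

Lemma measure_bigcup_fin d (T : measurableType d) (R : realType)
    (mu : {measure set T -> \bar R}) (I : finType) (F : I -> set T) :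
  (forall i, measurable (F i)) -> trivIset [set: I] F ->
  mu (\bigcup_i F i) = (\sum_i mu (F i))%E.
Proof.
move=> mF tF.
have -> : \bigcup_i F i = \big[setU/set0]_i F i.
  rewrite -bigcup_seq; apply: eq_bigcupl.
  by split => i //= _; exact: mem_index_enum.
(* Numbering [I] by [enum_val] reduces the claim to additivity over ordinals. *)
rewrite !(reindex _ (onW_bij _ (@enum_val_bij I)))/= measure_bigsetU_ord//.
by move=> i k _ _ Fik; apply: enum_val_inj; exact: tF.
Qed.

Lemma measurable_frac (R : realType) : measurable_fun [set: R] (@Defs.frac R).
Proof.
apply: measurable_funB => //; apply: nondecreasing_measurable => // x y xy.
by rewrite ler_int; exact: le_floor.
Qed.

Lemma measurable_frac_shift (R : realType) (c : R) (J : interval R) :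
  measurable [set x | Defs.frac (x + c) \in J].
Proof.
rewrite -[X in measurable X]setTI.
have : measurable_fun [set: R] (@Defs.frac R \o (fun x => x + c)).
  apply: measurableT_comp; first exact: measurable_frac.
  exact: measurable_funD.
by move=> /(_ measurableT [set` J] (measurable_itv J)).
Qed.

(** The density is 1 on [[0, 1]], and the endpoint 1 is null. Dropping it ensures that for
    [0 < c <= 1] the floor of [x + c] is only 0 or 1. *)
Lemma uniform_probE (R : realType) (A : set R) : measurable A ->
  uniform_prob (@ltr01 R) A = lebesgue_measure (A `&` `[0, 1[).
Proof.
move=> mA; rewrite /uniform_prob integral_uniform_pdf.
rewrite (eq_integral (cst 1%E)); last first.
  move=> x /[!inE] -[_]; rewrite /= in_itv/= /uniform_pdf => ->.
  by rewrite subr0 invr1.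
rewrite integral_cst ?mul1e; last exact: measurableI.
rewrite -!integral_indic// integral_itv_bndo_bndc//.
by apply/measurable_EFinP; exact: measurable_indic.
Qed.

(** Rotation invariance of length on the circle: before the wrap [x + c] lies in [[a, b[], after it
    in [[a + 1, b + 1[], and the two pieces have total length [b - a]. *)
Lemma uniform_frac_shift (R : realType) (a b c : R) :
  0 <= a -> a <= b -> b <= 1 -> 0 < c <= 1 ->
  uniform_prob (@ltr01 R) [set x | Defs.frac (x + c) \in `[a, b[] = (b - a)%:E.
Proof.
move=> a0 ab b1 /andP[c0 c1].
rewrite uniform_probE; last exact: measurable_frac_shift.
(* Cut at the point [1 - c] where [x + c] wraps around. *)
pose lo : R := Num.max 0 (a - c); pose hi : R := Num.min (b + 1 - c) 1.
have -> : [set x | Defs.frac (x + c) \in `[a, b[] `&` `[0, 1[ =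
    `[lo, b - c[ `|` `[a + 1 - c, hi[.
  apply/seteqP; split => x /=; rewrite !in_itv/= /lo /hi ge_max lt_min.
    move=> [+ /andP[x0 x1]]; case: (ltP (x + c) 1) => xc.
      rewrite (@frac_eq _ _ 0) ?subr0 => [/andP[h1 h2]|]; last first.
        by apply/andP; split; lra.
      by left; apply/andP; split; [apply/andP; split|]; lra.
    rewrite (@frac_eq _ _ 1) => [/andP[h1 h2]|]; last first.
      by apply/andP; split; lra.
    by right; apply/andP; split; [|apply/andP; split]; lra.
  move=> [/andP[/andP[h1 h2] h3]|/andP[h1 /andP[h2 h3]]].
    split; last by apply/andP; split; lra.
    rewrite (@frac_eq _ _ 0) ?subr0; first by apply/andP; split; lra.
    by apply/andP; split; lra.
  split; last by apply/andP; split; lra.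
  rewrite (@frac_eq _ _ 1); first by apply/andP; split; lra.
  by apply/andP; split; lra.
rewrite measureU//; last first.
  rewrite -subset0 => x /= [].
  rewrite !in_itv/= /lo /hi ge_max lt_min.
  by move=> /andP[/andP[h1 h2] h3] /andP[h4 /andP[h5 h6]]; lra.
rewrite /= !lebesgue_measure_itv/= !lte_fin /lo /hi.
(* A piece may be empty, the first when [b <= c], the second when [c <= a]; it then contributes 0.
   Every case is linear. *)
case: ltP => h1; case: ltP => h2; rewrite -?EFinB -?EFinD ?adde0 ?add0e; congr (_%:E);
  move: h1 h2; case: (leP 0 (a - c)) => h3; case: (leP (b + 1 - c) 1) => h4 h1 h2;
  lra.
Qed.

(** * Probability that a given position is selected *)

Section line_committee_probability.
Variables (R : realType) (N M : nat) (v : 'I_N -> R) (j : 'I_N).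

Lemma line_committee_bigcup : [set x | j \in line_committee M v x] =
  \bigcup_(i : 'I_M) [set x | Defs.frac (x + i.+1%:R / M%:R) \in subinterval v j].
Proof.
apply/seteqP; split => x /=; rewrite inE; first by move=> /existsP[i]; exists i.
by move=> [i _ ij]; apply/existsP; exists i.
Qed.

Lemma measurable_line_committee : measurable [set x | j \in line_committee M v x].
Proof.
rewrite line_committee_bigcup; apply: fin_bigcup_measurable => [|i _].
  exact: finite_finset.
exact: measurable_frac_shift.
Qed.

Lemma uniform_line_committee :
  (forall k, 0 <= v k) -> v j < 1 / M%:R -> \sum_k v k = 1 ->
  uniform_prob (@ltr01 R) [set x | j \in line_committee M v x] =
  (M%:R * v j)%:E.
Proof.
move=> v0 vM v1; rewrite line_committee_bigcup measure_bigcup_fin; last 2 first.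
- by move=> i; exact: measurable_frac_shift.
- move=> i k _ _ [x [xi xk]]; apply: frac_shift_inj xi xk.
  by rewrite subinterval_length.
rewrite (eq_bigr (fun=> (v j)%:E)) => [|i _].
  by rewrite sumEFin sumr_const card_ord mulr_natl.
transitivity (\sum_(k < N | (k <= j)%N) v k - \sum_(k < N | (k < j)%N) v k)%:E.
  apply: uniform_frac_shift.
  - exact: sumr_ge0.
  - by rewrite -subr_ge0 subinterval_length.
  - by rewrite -v1 [leLHS]big_mkcond; apply: ler_sum => k _; case: ifP.
  (* The shift [i.+1 / M] is positive and reaches 1 at the last index; the existence of [i : 'I_M]
     already forces [M] to be positive. *)
  - have M0 : 0 < M%:R :> R by rewrite ltr0n; case: (M) i => [[]|].
    by rewrite divr_gt0//= ler_pdivrMr// mul1r ler_nat.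
by rewrite subinterval_length.
Qed.

End line_committee_probability.

(** * The permutation step and the voting power *)

Lemma mem_stitch_committee (R : realType) (N M : nat) (w : 'I_N -> R)
    (p : {perm 'I_N}) (x : R) (n : 'I_N) :
  (n \in stitch_committee M w p x) =
  ((p^-1)%g n \in line_committee M (fun j => w (p j)) x).
Proof. by rewrite -{1}(permKV p n) mem_imset//; exact: perm_inj. Qed.

(** Lets both branches of the optional step be treated alike: without a permutation [s] is constant,
    so its preimages are the whole space or empty, and independence is immediate. *)
Lemma permutation_step_indep {d} {T : measurableType d} {R : realType}
    {P : probability T R} {X : {RV P >-> R}} {N : nat} {permute : bool}
    {s : T -> {perm 'I_N}} : permutation_step X permute s ->
  (forall p, measurable (s @^-1` [set p])) /\
  (forall p (A : set R), measurable A ->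
    P (s @^-1` [set p] `&` X @^-1` A) =
    (P (s @^-1` [set p]) * P (X @^-1` A))%E).
Proof.
case: permute => [[ms _ indep]//|/= s1].
have sE p : s @^-1` [set p] = if p == 1%g then [set: T] else set0.
  apply/seteqP; split => t /=; first by rewrite s1 => ->; rewrite eqxx.
  by case: eqP => // ->.
split=> [p|p A mA]; rewrite sE; case: eqP => // _.
  by rewrite setTI probability_setT mul1e.
by rewrite set0I measure0 mul0e.
Qed.

Lemma voting_power_stitch (R : realType) (N : nat) (C : {set 'I_N}) (n : 'I_N) :
  voting_power C (stitch_weights R C) n = #|C|%:R^-1 * (n \in C)%:R.
Proof.
rewrite /voting_power /stitch_weights; case: ifP => nC; last by rewrite mulr0.
rewrite mulr1 (eq_bigr (fun=> 1)) => [|m ->//].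
by rewrite sumr_const nC div1r.
Qed.

(** * Selection probability of a participant, and fairness *)

Section stitch.
Variables (R : realType) (N M : nat) (w : 'I_N -> R).
Hypotheses (M_gt0 : (0 < M)%N) (w_ge0 : forall n, 0 <= w n)
  (w_sum1 : \sum_(n < N) w n = 1) (w_max : forall n, w n < 1 / M%:R).

Let sum_perm (p : {perm 'I_N}) : \sum_j w (p j) = 1.
Proof. by rewrite -w_sum1 [RHS](reindex_inj (@perm_inj _ p)). Qed.

Lemma card_stitch_committee (p : {perm 'I_N}) (x : R) :
  #|stitch_committee M w p x| = M.
Proof. by rewrite card_imset ?card_line_committee//; exact: perm_inj. Qed.

Variables (d : measure_display) (T : measurableType d) (P : probability T R).
Variables (X : {RV P >-> R}) (permute : bool) (s : T -> {perm 'I_N}).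
Hypotheses (X_unif : uniform01 X) (s_perm : permutation_step X permute s).

Let seated (n : 'I_N) (p : {perm 'I_N}) : set R :=
  [set x | n \in stitch_committee M w p x].

Let seatedE n p : seated n p =
  [set x | (p^-1)%g n \in line_committee M (fun j => w (p j)) x].
Proof. by apply/funext => x; rewrite /seated/= mem_stitch_committee. Qed.

Let measurable_seated n p : measurable (seated n p).
Proof. by rewrite seatedE; exact: measurable_line_committee. Qed.

(** Participant [n] sits at position [p^-1 n], whose weight is [w (p (p^-1 n)) = w n]; hence the
    value is the same for every [p]. *)
Let prob_seated n p : P (X @^-1` seated n p) = (M%:R * w n)%:E.
Proof.
have /= := X_unif _ (measurable_seated n p).
rewrite /distribution/= /pushforward => ->.
by rewrite seatedE uniform_line_committee// permKV.
Qed.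

(** Splitting by the value of [s] prepares the law of total probability. *)
Let selected_bigcup n : [set t | n \in stitch_committee M w (s t) (X t)] =
  \bigcup_(p : {perm 'I_N}) (s @^-1` [set p] `&` X @^-1` seated n p).
Proof.
apply/seteqP; split => t /=; first by move=> nC; exists (s t).
by move=> [p _ [/= -> ]].
Qed.

Let measurable_piece n p : measurable (s @^-1` [set p] `&` X @^-1` seated n p).
Proof.
have [ms _] := permutation_step_indep s_perm.
apply: measurableI => //; rewrite -[X in measurable X]setTI.
exact: measurable_funPT.
Qed.

Lemma measurable_selected n :
  measurable [set t | n \in stitch_committee M w (s t) (X t)].
Proof.
rewrite selected_bigcup; apply: fin_bigcup_measurable => //.
exact: finite_finset.
Qed.

Lemma prob_selected n :
  P [set t | n \in stitch_committee M w (s t) (X t)] = (M%:R * w n)%:E.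
Proof.
have [ms indep] := permutation_step_indep s_perm.
rewrite selected_bigcup measure_bigcup_fin//; last first.
  by move=> p q _ _ [t [[<- _] [<- _]]].
rewrite (eq_bigr (fun p => (P (s @^-1` [set p]) * (M%:R * w n)%:E)%E)); last first.
  by move=> p _; rewrite -(prob_seated n p); exact: indep.
(* The common factor [M * w n] comes out of the sum, and the probabilities of the disjoint events
   [s = p] add up to 1. *)
rewrite -ge0_sume_distrl// -measure_bigcup_fin//; last first.
  by move=> p q _ _ [t [<- <-]].
have -> : \bigcup_p (s @^-1` [set p]) = setT.
  by apply/seteqP; split => // t _; exists (s t).
by rewrite [X in (X * _)%E](probability_setT P) mul1e.
Qed.

Lemma fair_stitch : fair P w (fun t => stitch_committee M w (s t) (X t))
  (fun t => stitch_weights R (stitch_committee M w (s t) (X t))).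
Proof.
move=> n; set B := [set t | n \in stitch_committee M w (s t) (X t)].
have mB : measurable B := measurable_selected n.
pose V t := voting_power (stitch_committee M w (s t) (X t))
  (stitch_weights R (stitch_committee M w (s t) (X t))) n.
(* As the committee always has [M] members, the voting power is [1 / M] times the indicator of
   selection, so its expectation is [M * w n / M]. *)
have VE : V = M%:R^-1 \o* (\1_B : T -> R).
  apply/funext => t; rewrite /V voting_power_stitch card_stitch_committee /=.
  by rewrite mulrC indicE /B mem_setE.
have iB : (\1_B : T -> R) \in Lfun P 1.
  by apply/Lfun1_integrable; exact: integrable_indic.
split; first by apply/(Lfun1_integrable P V); rewrite VE Lfun_scale.
rewrite -/V VE.
rewrite expectationZl// expectation_indic// prob_selected -EFinM mulKf//.
by rewrite pnatr_eq0 -lt0n.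
Qed.

End stitch.

Theorem proposition4p1 (R : realType) (N M : nat) (w : 'I_N -> R)
    (M_gt0 : (0 < M)%N)
    (w_gt0 : forall n, 0 < w n)
    (w_sum1 : \sum_(n < N) w n = 1)
    (w_max : \big[Num.max/0]_(n < N) w n < 1 / M%:R)
    (d : measure_display) (T : measurableType d) (P : probability T R)
    (X : {RV P >-> R}) (X_unif : uniform01 X)
    (permute : bool) (s : T -> {perm 'I_N})
    (s_perm : permutation_step X permute s) :
  let C := fun t : T => stitch_committee M w (s t) (X t) in
  let g := fun t : T => stitch_weights R (C t) in
  fair P w C g /\ (forall t : T, #|C t| = M).
Proof.
move=> C g.
have wM n : w n < 1 / M%:R by apply: le_lt_trans w_max; exact: le_bigmax.
have w0 n : 0 <= w n by exact: ltW.
split => [|t]; last exact: card_stitch_committee.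
exact: (fair_stitch _ _ _ _ M_gt0 w0 w_sum1 wM _ _ _ _ _ _ X_unif s_perm).
Qed.
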